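(* Let $(V, e)$ be an order unit space and let $Bd(V^+)$ denote the boundary of $V^+$ in $V$ with respect to the norm $\Vert\cdot\Vert$. Then $R_V = C_V \cap Bd(V^+)$.
   Context: Order unit space: a real vector space $V$ with a proper Archimedean cone $V^+$ and an order unit $e \in V^+$; $\Vert v \Vert = \inf\{k > 0 : ke \pm v \in V^+\}$ is the order unit norm. Put $C_V = \{u \in V^+ : \Vert u \Vert = 1\}$ (the canopy) and $R_V = C_V \cap (e - C_V) = \{u \in V^+ : \Vert u \Vert = 1 = \Vert e - u \Vert\}$ (the periphery). *)

(* Defs.v *)
From HB Require Import structures.
From mathcomp Require Import all_boot all_order all_algebra.
From mathcomp Require Import all_classical all_reals all_analysis.

Set Implicit Arguments.
Unset Strict Implicit.
Unset Printing Implicit Defensive.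

Import Order.TTheory GRing.Theory Num.Theory.
Import numFieldNormedType.Exports.

Local Open Scope classical_set_scope.
Local Open Scope ring_scope.

HB.mixin Record isOrderUnitSpace (R : realType) V & NormedModule R V := {
  pos_cone : set V;
  order_unit : V;
  pos_coneD : forall u v, pos_cone u -> pos_cone v -> pos_cone (u + v);
  pos_coneZ : forall (k : R) u, 0 <= k -> pos_cone u -> pos_cone (k *: u);
  pos_cone_proper : forall u, pos_cone u -> pos_cone (- u) -> u = 0;
  pos_cone_archimedean : forall u v, pos_cone u ->
    (forall k : R, 0 < k -> pos_cone (k *: u + v)) -> pos_cone v;
  order_unit_pos : pos_cone order_unit;
  order_unit_dominates : forall v, exists k : R, [/\ 0 < k,
    pos_cone (k *: order_unit + v) & pos_cone (k *: order_unit - v)];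
  order_unit_norm : forall v : V, `|v| = inf [set k : R | [/\ 0 < k,
    pos_cone (k *: order_unit + v) & pos_cone (k *: order_unit - v)]]
}.

#[short(type="orderUnitSpaceType")]
HB.structure Definition OrderUnitSpace (R : realType) :=
  {V of isOrderUnitSpace R V & NormedModule R V}.

Arguments pos_cone {R} V : rename.
Arguments order_unit {R} V : rename.

(* The normed module underlying an [orderUnitSpaceType] is no extra data: a bare
   real vector space with a proper Archimedean cone and an order unit becomes an
   order unit space, the infimum defining the norm being shown to be a norm. *)
HB.factory Record Lmodule_isOrderUnitSpace (R : realType) V
    & GRing.Lmodule R V := {
  pos_cone : set V;
  order_unit : V;
  pos_coneD : forall u v, pos_cone u -> pos_cone v -> pos_cone (u + v);
  pos_coneZ : forall (k : R) u, 0 <= k -> pos_cone u -> pos_cone (k *: u);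
  pos_cone_proper : forall u, pos_cone u -> pos_cone (- u) -> u = 0;
  pos_cone_archimedean : forall u v, pos_cone u ->
    (forall k : R, 0 < k -> pos_cone (k *: u + v)) -> pos_cone v;
  order_unit_pos : pos_cone order_unit;
  order_unit_dominates : forall v, exists k : R, [/\ 0 < k,
    pos_cone (k *: order_unit + v) & pos_cone (k *: order_unit - v)]
}.

HB.builders Context R V & Lmodule_isOrderUnitSpace R V.
Implicit Types (u v : V) (k : R).

Let ou_bounds v : set R := [set k | [/\ 0 < k,
  pos_cone (k *: order_unit + v) & pos_cone (k *: order_unit - v)]].

Let ou_norm v : R := inf (ou_bounds v).

Let ou_bounds_neq0 v : ou_bounds v !=set0.
Proof. exact: order_unit_dominates. Qed.

Let ou_bounds_lb0 v : lbound (ou_bounds v) 0.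
Proof. by move=> k [/ltW]. Qed.

Let ou_bounds_has_inf v : has_inf (ou_bounds v).
Proof. by split=> //; exists 0; exact: ou_bounds_lb0. Qed.

Let ou_norm_ge0 v : 0 <= ou_norm v.
Proof. exact: lb_le_inf. Qed.

Let ou_norm_le v k : ou_bounds v k -> ou_norm v <= k.
Proof. by apply: ge_inf; exists 0; exact: ou_bounds_lb0. Qed.

Let ou_norm_triangle u v : ou_norm (u + v) <= ou_norm u + ou_norm v.
Proof.
apply/ler_addgt0Pr => e e0.
have e20 : 0 < e / 2 by rewrite divr_gt0.
have [k [k0 ku1 ku2] kle] := inf_adherent e20 (ou_bounds_has_inf u).
have [l [l0 lv1 lv2] lle] := inf_adherent e20 (ou_bounds_has_inf v).
apply: (@le_trans _ _ (k + l)); last first.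
  by rewrite [e]splitr addrACA lerD// ltW.
apply: ou_norm_le; split; first exact: addr_gt0.
  by rewrite scalerDl addrACA; exact: pos_coneD.
by rewrite scalerDl opprD addrACA; exact: pos_coneD.
Qed.

Let ou_normN v : ou_norm (- v) = ou_norm v.
Proof.
by rewrite /ou_norm; congr inf; apply/seteqP; split=> k [k0 ? ?];
  split=> //; rewrite ?opprK// -[v]opprK.
Qed.

Let ou_normZ_le k v : 0 < k -> ou_norm (k *: v) <= k * ou_norm v.
Proof.
move=> k0; rewrite -ler_pdivrMl//; apply: lb_le_inf => // l [l0 lv1 lv2].
rewrite ler_pdivrMl//; apply: ou_norm_le; split; first exact: mulr_gt0.
  by rewrite -scalerA -scalerDr; apply: pos_coneZ => //; exact: ltW.
by rewrite -scalerA -scalerBr; apply: pos_coneZ => //; exact: ltW.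
Qed.

Let ou_norm0 : ou_norm (0 : V) = 0.
Proof.
apply/le_anti; rewrite ou_norm_ge0 andbT; apply/ler_addgt0Pr => e e0.
rewrite add0r; apply: ou_norm_le.
by split=> //; rewrite ?subr0 ?addr0; apply: pos_coneZ (ltW e0) _;
  exact: order_unit_pos.
Qed.

Let ou_normZ_gt0 k v : 0 < k -> ou_norm (k *: v) = k * ou_norm v.
Proof.
move=> k0; apply/le_anti; rewrite ou_normZ_le//= -ler_pdivlMl//.
rewrite -{1}[v]scale1r -(mulVf (lt0r_neq0 k0)) -scalerA.
by rewrite ou_normZ_le// invr_gt0.
Qed.

Let ou_norm_scale k v : ou_norm (k *: v) = `|k| * ou_norm v.
Proof.
have [k0|k0|->] := ltgtP k 0; last by rewrite scale0r ou_norm0 normr0 mul0r.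
  by rewrite ltr0_norm// -ou_normN -scaleNr ou_normZ_gt0// oppr_gt0.
by rewrite gtr0_norm// ou_normZ_gt0.
Qed.

Let ou_norm_eq0 v : ou_norm v = 0 -> v = 0.
Proof.
move=> v0.
have H k : 0 < k -> pos_cone (k *: order_unit + v) /\
                    pos_cone (k *: order_unit - v).
  move=> k0.
  have [l [l0 lv1 lv2]] := inf_adherent k0 (ou_bounds_has_inf v).
  rewrite -/(ou_norm v) v0 add0r => /ltW lk.
  have kl : pos_cone ((k - l) *: order_unit).
    by apply: pos_coneZ; [rewrite subr_ge0|exact: order_unit_pos].
  have -> : k *: order_unit = (k - l) *: order_unit + l *: order_unit.
    by rewrite -scalerDl subrK.
  by rewrite -!addrA; split; exact: pos_coneD.
apply: pos_cone_proper; apply: (pos_cone_archimedean order_unit_pos).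
  by move=> k /H[].
by move=> k /H[].
Qed.

HB.instance Definition _ := Lmodule_isNormed.Build R V
  ou_norm_triangle ou_norm_scale ou_norm_eq0.

HB.instance Definition _ := isOrderUnitSpace.Build R V
  pos_coneD pos_coneZ pos_cone_proper pos_cone_archimedean
  order_unit_pos order_unit_dominates (fun=> erefl).

HB.end.

Definition canopy (R : realType) (V : orderUnitSpaceType R) : set V :=
  [set u | pos_cone V u /\ `|u| = 1].
Arguments canopy {R} V.

Definition periphery (R : realType) (V : orderUnitSpaceType R) : set V :=
  canopy V `&` [set order_unit V - u | u in canopy V].
Arguments periphery {R} V.

Lemma pos_cone_norm (R : realType) (V : orderUnitSpaceType R) (v : V) (k : R) :
  `|v| <= k -> pos_cone V (k *: order_unit V - v).
Proof.
move=> vk; apply: (pos_cone_archimedean _ _ (@order_unit_pos R V)) => e e0.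
set B := [set k : R | [/\ 0 < k,
    pos_cone V (k *: order_unit V + v) & pos_cone V (k *: order_unit V - v)]].
have hB : has_inf B.
  split; first exact: order_unit_dominates.
  by exists 0 => l [/ltW].
have [l [l0 _ lv] lle] := inf_adherent e0 hB.
rewrite -[inf B]order_unit_norm in lle.
have -> : e *: order_unit V + (k *: order_unit V - v) =
  (e + k - l) *: order_unit V + (l *: order_unit V - v).
  by rewrite !addrA -!scalerDl subrK.
apply: pos_coneD => //; apply: pos_coneZ; last exact: order_unit_pos.
by rewrite subr_ge0 (le_trans (ltW lle))// addrC lerD2l.
Qed.

Lemma peripheryE (R : realType) (V : orderUnitSpaceType R) :
  periphery V = [set u | [/\ pos_cone V u, `|u| = 1 & `|order_unit V - u| = 1]].
Proof.
apply/seteqP; split => [u [[u0 u1]] [w [w0 w1] uE]|u [u0 u1 e1]].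
  by split => //; rewrite -uE opprB addrC subrK.
split => //; exists (order_unit V - u); last by rewrite opprB addrC subrK.
by split => //; rewrite -[order_unit V]scale1r; apply: pos_cone_norm; rewrite u1.
Qed.

Definition boundary (T : topologicalType) (A : set T) : set T :=
  closure A `\` interior A.

(* Main.v *)
Require Import Defs.
From mathcomp Require Import all_boot all_order all_algebra.
From mathcomp Require Import all_classical all_reals all_analysis.

Import Order.TTheory GRing.Theory Num.Theory.
Import numFieldNormedType.Exports.

(** Both sides concern a positive [u] of norm 1, and for such a [u] the bounds
    [0 <= u <= e] already give [`|e - u| <= 1]. So the periphery asks that this
    inequality be an equality, while the boundary asks that [u] not be interior
    (a point of the cone lies in its closure anyway). The two conditions match
    because [u] is interior exactly when [`|e - u| < 1] (lemma
    [interior_pos_cone_normB]): the unit ball centred at [e] lies in the cone,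
    since [e - w <= e] means [0 <= w], and conversely an interior [u] dominates
    some [t *: e] with [t > 0], so that [0 <= e - u <= (1 - t) *: e]. *)

Local Open Scope classical_set_scope.
Local Open Scope ring_scope.

Lemma norm_order_unit_le (R : realType) (V : orderUnitSpaceType R)
    (v : V) (k : R) :
  0 < k -> pos_cone V (k *: order_unit V + v) ->
  pos_cone V (k *: order_unit V - v) -> `|v| <= k.
Proof.
move=> k0 kv1 kv2; rewrite order_unit_norm; apply: ge_inf => //.
by exists 0 => l [/ltW].
Qed.

Lemma norm_order_unit_le1 (R : realType) (V : orderUnitSpaceType R) :
  `|order_unit V| <= 1.
Proof.
have e_ge0 := @order_unit_pos R V.
apply: norm_order_unit_le; rewrite ?scale1r //; first exact: pos_coneD.
by rewrite subrr -[0](scale0r (order_unit V)); exact: pos_coneZ.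
Qed.

(** The bound [t *: e <= u] gives [e - u <= (1 - t) *: e], and the opposite
    bound [- (1 - t) *: e <= e - u] already follows from [u <= e] and
    [t < 1]. The case [t = 0] says that [e - u] has norm at most 1; a positive
    [t] makes that bound strict. *)
Lemma norm_order_unitB_le (R : realType) (V : orderUnitSpaceType R)
    (u : V) (t : R) :
  t < 1 -> `|u| <= 1 -> pos_cone V (u - t *: order_unit V) ->
  `|order_unit V - u| <= 1 - t.
Proof.
move=> t1 u1 ut; set e := order_unit V in ut *.
apply: norm_order_unit_le; first by rewrite subr_gt0.
  rewrite -/e addrA -{2}[e]scale1r -scalerDl.
  apply: pos_cone_norm; apply: le_trans u1 _.
  by rewrite lerDr subr_ge0 ltW.
by rewrite -/e scalerBl scale1r opprB addrC addrA subrK.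
Qed.

Lemma norm_order_unitB_pos_cone (R : realType) (V : orderUnitSpaceType R)
    (u : V) :
  `|order_unit V - u| <= 1 -> pos_cone V u.
Proof. by move=> /pos_cone_norm; rewrite scale1r opprB addrC subrK. Qed.

(** Since [e] is an order unit, interiority only has to be tested in the single
    direction [- e], and the distance from [u] to [e] detects how far [u] can be
    moved that way. *)
Lemma interior_pos_cone_normB (R : realType) (V : orderUnitSpaceType R)
    (u : V) :
  `|u| <= 1 -> (pos_cone V)° u <-> `|order_unit V - u| < 1.
Proof.
move=> u1; split; last first.
  move=> eu1; apply/nbhs_normP; exists (1 - `|order_unit V - u|).
    by rewrite /= subr_gt0.
  move=> w /= uw; apply: norm_order_unitB_pos_cone.
  rewrite -[order_unit V](subrK u) -addrA.
  apply: le_trans (ler_normD _ _) _.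
  by rewrite -lerBrDl ltW.
move=> /nbhs_normP[r /= r0 ball_pos].
(* Any [t < Num.min r 1] works: [t < r] keeps [u - t *: e] in the ball, and
   [t < 1] makes the bound [1 - t] positive. *)
have m0 : 0 < Num.min r 1 by rewrite lt_min r0 ltr01.
pose t := Num.min r 1 / 2.
have t0 : 0 < t by rewrite divr_gt0.
have : t < Num.min r 1 by rewrite /t gtr_pMr // invf_lt1 // ltr1n.
rewrite lt_min => /andP[tr t1].
apply: (@le_lt_trans _ _ (1 - t)); last by rewrite gtrBl.
apply: norm_order_unitB_le => //; apply: ball_pos => /=.
rewrite opprB addrC subrK normrZ gtr0_norm //; apply: le_lt_trans tr.
by rewrite ler_piMr ?norm_order_unit_le1 // ltW.
Qed.

Local Close Scope ring_scope.

Theorem theorem4p1 (R : realType) (V : orderUnitSpaceType R) :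
  periphery V = canopy V `&` boundary (pos_cone V).
Proof.
rewrite peripheryE; apply/seteqP; split=> u /=.
  move=> [u_ge0 u1 eu1]; split=> //; split; first exact: subset_closure.
  by move=> /interior_pos_cone_normB; rewrite u1 eu1 ltxx lexx => /(_ isT).
move=> [[u_ge0 u1] [_ u_nint]]; split=> //.
apply/le_anti/andP; split.
  rewrite -[leRHS]subr0; apply: norm_order_unitB_le.
  - exact: ltr01.
  - by rewrite u1.
  - by rewrite scale0r subr0.
rewrite leNgt; apply/negP => eu_lt1; apply: u_nint.
by apply/interior_pos_cone_normB; rewrite ?u1.
Qed.
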